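(* Let $F$ be a field. If $n\geqslant 349$, then $M_n(F)$ admits a grading by an infinite group that is not weakly equivalent to any grading by a finite (semi)group.
   Context: A grading of an $F$-algebra $A$ by a (semi)group $S$ is a decomposition $A=\bigoplus_{s\in S}A^{(s)}$ into subspaces with $A^{(s)}A^{(t)}\subseteq A^{(st)}$ for all $s,t\in S$ (components may be zero). Two gradings $A=\bigoplus_{s\in S}A^{(s)}$ and $B=\bigoplus_{t\in T}B^{(t)}$ by (semi)groups are weakly equivalent if there is an algebra isomorphism $\varphi\colon A\to B$ such that for every $s\in S$ with $A^{(s)}\neq0$ there is $t\in T$ with $\varphi(A^{(s)})=B^{(t)}$. ''(Semi)group'' means a group or, more generally, a semigroup. *)

(* Defs.v *)
From HB Require Import structures.
From mathcomp Require Import all_boot all_order all_algebra.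
From mathcomp Require Import boolp classical_sets cardinality.

Set Implicit Arguments.
Unset Strict Implicit.
Unset Printing Implicit Defensive.

Import GRing.Theory.
Local Open Scope classical_set_scope.
Local Open Scope ring_scope.

Definition is_subspace (F : fieldType) (A : lmodType F) (V : set A) : Prop :=
  V 0 /\ forall (a : F) (u v : A), V u -> V v -> V (a *: u + v).

(* Internal direct sum over a possibly infinite index set: only finite sums
   occur, taken over duplicate-free lists of indices. *)
Definition is_direct_sum (F : fieldType) (A : lmodType F) (S : eqType)
    (V : S -> set A) : Prop :=
  [/\ forall s, is_subspace (V s),
      forall x : A, exists (r : seq S) (c : S -> A),
        [/\ uniq r, forall s, V s (c s) & x = \sum_(s <- r) c s]
    & forall (r : seq S) (c : S -> A),
        uniq r -> (forall s, V s (c s)) -> \sum_(s <- r) c s = 0 ->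
        forall s, s \in r -> c s = 0].

(* Components may be zero. *)
Definition is_grading (F : fieldType) (A : algType F) (S : semigroupType)
    (V : S -> set A) : Prop :=
  is_direct_sum V /\
  forall (s t : S) (x y : A), V s x -> V t y -> V (s * t)%g (x * y).

(* {lrmorphism A -> B} also asks for 1 |-> 1, which any bijective
   multiplicative map between unital algebras satisfies. *)
Definition weakly_equivalent (F : fieldType) (A B : algType F)
    (S T : semigroupType) (V : S -> set A) (W : T -> set B) : Prop :=
  exists phi : {lrmorphism A -> B},
    bijective phi /\
    forall s : S, V s <> [set 0] -> exists t : T, phi @` V s = W t.

(* Main.v *)
Require Import Defs.
From HB Require Import structures.
From mathcomp Require Import all_boot all_order all_algebra.
From mathcomp Require Import boolp classical_sets cardinality.
From mathcomp Require Import zify ring.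

Set Implicit Arguments.
Unset Strict Implicit.
Unset Printing Implicit Defensive.

Import GRing.Theory.
Local Open Scope classical_set_scope.
Local Open Scope ring_scope.

(** The grading is elementary: fix elements [g_i] of a group [G] and give the
    matrix unit [e_ij] the degree [g_i^-1 g_j].  A weak equivalence with a
    grading by a semigroup [T] assigns to every matrix unit a degree [d i j] in
    [T], and [e_ij e_jk = e_ik] forces [d i j * d j k = d i k], while
    [d i j = d k l] holds exactly when [g_i^-1 g_j = g_k^-1 g_l]
    ([weak_equivalence_degrees]).  So the part of the multiplication table of
    [G] that is visible on the differences of the [g_i] is copied faithfully
    into [T].

    It remains to choose finitely many elements of a group whose visible
    relations have no faithful copy in a finite semigroup.  Take [h], [t], [x]
    with [t h t^-1 = h^2], [x h^2 = h^2 x] and [x h <> h x].  If [h] had finite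
    order [m], then [m] would be odd, because the conjugate elements [h] and
    [h^2] have the same order; hence [h] would be a power of [h^2] and would
    commute with [x] ([finite_semigroup_commute]).  Nine elements [g_i] suffice
    to see all these relations ([difference_table_commute]); the other [g_i]
    are taken to be [1].

    Such [h], [t], [x] exist among the permutations of the rational numbers:
    [h] is translation by 1, [t] is multiplication by 2, and [x] is translation
    by 2 on the even integers and the identity elsewhere.

    Finally, the group is infinite for free: the graded algebra is weakly
    equivalent to itself, so a finite group would contradict what has just been
    proved. *)

(** * Powers in a finite semigroup *)

Lemma finite_set_not_injective (T : Type) (f : nat -> T) :
  finite_set [set: T] -> exists a b, (a < b)%N /\ f a = f b.
Proof.
move=> finT; apply: contrapT => noab.
have finj : injective f.
  move=> a b fab; case: (ltngtP a b) => // ltab; case: noab.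
  - by exists a, b.
  - by exists b, a.
apply: infinite_nat; rewrite -(preimage_setT f).
by apply: finite_preimage => // a b _ _; exact: finj.
Qed.

(** In a finite semigroup, suppose that [h] and [t] generate a group with
    identity [e] in which [t] conjugates [h] to its square.  Then [h] has odd
    order, so it is a power of its square and commutes with whatever commutes
    with that square. *)
Lemma finite_semigroup_commute (T : semigroupType) (e h h' t t' x : T) :
    finite_set [set: T] ->
    (e * h = h)%g -> (h * e = h)%g -> (e * t = t)%g -> (t * e = t)%g ->
    (e * x = x)%g -> (x * e = x)%g -> (e * e = e)%g ->
    (h' * h = e)%g -> (t' * t = e)%g ->
    (t * h = h * h * t)%g -> (x * (h * h) = h * h * x)%g ->
  (x * h = h * x)%g.
Proof.
move=> finT eh he et te ex xe ee h'h t't th xhh.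
pose p k := iter k (fun z => h * z)%g e.
have pS k : p k.+1 = (h * p k)%g by [].
have ep k : (e * p k = p k)%g by case: k => [|k] //; rewrite pS mulgA eh.
have [m m_gt0 pm] : exists2 m, (0 < m)%N & p m = e.
  have [a [b [ltab pab]]] := finite_set_not_injective p finT.
  exists (b - a)%N; first lia.
  elim: a b ltab pab => [|a IHa] [|b] // ltab pab.
  rewrite subSS; apply: IHa => //.
  by rewrite -[p a]ep -[p b]ep -h'h -!mulgA -!pS pab.
(* The least exponent is wanted, since the parity argument halves it. *)
have exm : exists m, (0 < m)%N && (p m == e) by exists m; rewrite m_gt0 pm eqxx.
case: (ex_minnP exm) => {m m_gt0 pm exm} m /andP[m_gt0 /eqP pm] m_min.
have tp k : (t * p k = p k.*2 * t)%g.
  elim: k => [|k IHk]; first by rewrite /= te et.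
  by rewrite doubleS !pS mulgA th -mulgA IHk !mulgA.
have xp k : (x * p k.*2 = p k.*2 * x)%g.
  elim: k => [|k IHk]; first by rewrite /= xe ex.
  by rewrite doubleS !pS !mulgA -[(x * h * h)%g]mulgA xhh -!mulgA IHk.
have m_odd : odd m.
  apply/negPn/negP => m_even.
  have mE : m = m./2.*2 by rewrite -[LHS]odd_double_half (negbTE m_even).
  have phalf : p m./2 = e.
    by rewrite -[LHS]ep -t't -mulgA tp -mE pm et.
  have := m_min m./2; rewrite phalf eqxx andbT; lia.
(* [m + 1] is even and [h^(m+1) = h]. *)
have hE : p (m./2.+1).*2 = h.
  have <- : m.+1 = m./2.+1.*2 by rewrite doubleS -[in LHS](odd_double_half m) m_odd.
  by rewrite pS pm.
by rewrite -hE xp.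
Qed.

(** * Elementary gradings of matrix algebras *)

Lemma direct_sum_index_inj (F : fieldType) (A : lmodType F) (S : eqType)
    (V : S -> set A) (s t : S) (z : A) :
  is_direct_sum V -> z <> 0 -> V s z -> V t z -> s = t.
Proof.
move=> [subV _ indV] z0 Vs Vt; apply: contrapT => /eqP nst.
apply: z0; pose c u := if u == s then z else if u == t then - z else 0.
have := indV [:: s; t] c; rewrite /= inE nst => /(_ isT).
have cV u : V u (c u).
  have [V0 VL] := subV u; rewrite /c; case: eqP => [-> //|_].
  case: eqP => [ut|_ //]; rewrite {}ut in V0 VL *.
  by rewrite -scaleN1r -[_ *: z]addr0; apply: VL.
move=> /(_ cV); rewrite !big_cons big_nil /c eqxx [t == s]eq_sym (negbTE nst).
by rewrite eqxx addr0 subrr => /(_ erefl s); rewrite inE eqxx => /(_ isT).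
Qed.

(** Component [s] is spanned by the matrix units [e_ij] with
    [g_i^-1 g_j = s]. *)
Definition elementary_grading (F : fieldType) (G : groupType) (n : nat)
    (g : 'I_n.+1 -> G) (s : G) : set 'M[F]_n.+1 :=
  [set M | forall i j, M i j != 0 -> ((g i)^-1 * g j)%g = s].

Lemma elementary_grading_delta (F : fieldType) (G : groupType) (n : nat)
    (g : 'I_n.+1 -> G) i j :
  elementary_grading (F := F) g ((g i)^-1 * g j)%g (delta_mx i j).
Proof.
move=> k l; rewrite mxE.
by have [-> | _] := eqVneq k i; have [-> | _] := eqVneq l j; rewrite ?eqxx.
Qed.

Lemma elementary_grading_is_grading (F : fieldType) (G : groupType) (n : nat)
    (g : 'I_n.+1 -> G) : is_grading (elementary_grading (F := F) g).
Proof.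
split; first split.
- move=> s; split=> [i j|a u v Vu Vv i j]; first by rewrite mxE eqxx.
  rewrite !mxE => nz.
  have [/eqP u0|/Vu //] := boolP (u i j == 0).
  have [/eqP v0|/Vv //] := boolP (v i j == 0).
  by rewrite u0 v0 mulr0 addr0 eqxx in nz.
- move=> M; pose deg i j := ((g i)^-1 * g j)%g.
  exists (undup [seq deg p.1 p.2 | p : 'I_n.+1 * 'I_n.+1]).
  exists (fun s => \matrix_(i, j) if deg i j == s then M i j else 0); split.
  + exact: undup_uniq.
  + by move=> s i j; rewrite mxE; have [// | _] := eqVneq (deg i j) s; rewrite eqxx.
  + apply/matrixP => i j; rewrite summxE.
    rewrite (bigD1_seq (deg i j)) ?undup_uniq //=; last first.
      by rewrite mem_undup; apply/mapP; exists (i, j); rewrite ?mem_enum.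
    rewrite mxE eqxx big1 ?addr0 // => s /negbTE ns.
    by rewrite mxE eq_sym ns.
- move=> r c uniq_r cV sum0 s sr; apply/matrixP => i j; rewrite mxE.
  apply/eqP; apply: contraT => nz; move/matrixP/(_ i j): sum0.
  rewrite summxE mxE (bigD1_seq s) //= big1 ?addr0 => [c0|u us].
    by rewrite c0 eqxx in nz.
  apply/eqP; apply: contraT => /cV; rewrite (cV _ _ _ nz) => su.
  by rewrite su eqxx in us.
move=> s t M N VM VN i k; rewrite mxE => nz.
have [j nzj] : exists j, M i j * N j k != 0.
  apply: contrapT => no; move/negP: nz; apply; apply/eqP/big1 => j _.
  by apply/eqP; apply: contraT => nzj; case: no; exists j.
move: nzj; rewrite mulf_eq0 negb_or => /andP[/VM <- /VN <-].
by rewrite mulgA mulgK.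
Qed.

(** A weak equivalence transports the degrees of the matrix units, together
    with all the products and all the coincidences among these degrees. *)
Lemma weak_equivalence_degrees (F : fieldType) (G : groupType) (n : nat)
    (g : 'I_n.+1 -> G) (T : semigroupType) (B : algType F) (W : T -> set B) :
    is_grading W -> weakly_equivalent (elementary_grading (F := F) g) W ->
  exists d : 'I_n.+1 -> 'I_n.+1 -> T,
    (forall i j k, d i j * d j k = d i k)%g /\
    (forall i j k l,
       d i j = d k l <-> ((g i)^-1 * g j = (g k)^-1 * g l)%g).
Proof.
move=> [dirW mulW] [phi [/bij_inj phi_inj phiV]].
have [dirV _] := elementary_grading_is_grading F g.
have delta_n0 i j : delta_mx i j <> 0 :> 'M[F]_n.+1.
  by move/matrixP/(_ i j)/eqP; rewrite !mxE !eqxx oner_eq0.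
have phi_n0 i j : phi (delta_mx i j) <> 0.
  by rewrite -(rmorph0 phi) => /phi_inj; exact: delta_n0.
pose deg i j := ((g i)^-1 * g j)%g.
have /choice[d dE] : forall p : 'I_n.+1 * 'I_n.+1, exists u : T,
    phi @` elementary_grading (F := F) g (deg p.1 p.2) = W u.
  move=> [i j]; apply: phiV => Vs0.
  apply: (delta_n0 i j).
  have : elementary_grading (F := F) g (deg i j) (delta_mx i j).
    exact: elementary_grading_delta.
  by rewrite Vs0.
have Wd i j k l : deg i j = deg k l -> W (d (k, l)) (phi (delta_mx i j)).
  move=> eqd; rewrite -dE; exists (delta_mx i j) => //=; rewrite -eqd.
  exact: elementary_grading_delta.
exists (fun i j => d (i, j)); split=> [i j k|i j k l].
  apply: (direct_sum_index_inj dirW (@phi_n0 i k)); last exact: Wd.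
  by rewrite -[delta_mx i k](mul_delta_mx j) [phi _]rmorphM; apply: mulW; exact: Wd.
split=> [eqd|eqd].
  apply: (direct_sum_index_inj dirV (@delta_n0 i j)).
    exact: elementary_grading_delta.
  have : (phi @` elementary_grading (F := F) g (deg k l)) (phi (delta_mx i j)).
    by rewrite (dE (k, l)) -eqd; exact: Wd.
  by move=> [M VM /phi_inj <-].
by apply: (direct_sum_index_inj dirW (@phi_n0 i j)); exact: Wd.
Qed.

(** * A configuration without finite copies *)

(** Nine elements, chosen so that each of the products [t h], [h h], [h^2 t],
    [x h^2], [h^2 x], [x h] and [h x] is composed along a path that starts at
    [1] and stays in the list. *)
Definition obstruction (G : groupType) (h t x : G) : seq G :=
  [:: 1; h; h * h; t; t * h; x; x * (h * h); x * h; h * x]%g.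

(** A table of degrees in a finite semigroup that copies the differences of the
    nine elements contains a copy of [h], [t], [x] with invertible [h] and [t],
    and therefore identifies [x h] with [h x]. *)
Lemma difference_table_commute (G : groupType) (h t x : G) (n : nat)
    (g : 'I_n -> G) (T : semigroupType) (d : 'I_n -> 'I_n -> T) :
    (t * h = h * h * t)%g -> (x * (h * h) = h * h * x)%g ->
    (forall a, a \in obstruction h t x -> exists i, g i = a) ->
    finite_set [set: T] ->
    (forall i j k, d i j * d j k = d i k)%g ->
    (forall i j k l,
       d i j = d k l <-> ((g i)^-1 * g j = (g k)^-1 * g l)%g) ->
  (x * h = h * x)%g.
Proof.
move=> th xhh gX finT dM dE.
have [|i1 g1] := gX 1%g; first by rewrite !inE eqxx ?orbT.
have [|ih gh] := gX h; first by rewrite !inE eqxx ?orbT.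
have [|ihh ghh] := gX (h * h)%g; first by rewrite !inE eqxx ?orbT.
have [|it gt] := gX t; first by rewrite !inE eqxx ?orbT.
have [|ith gth] := gX (t * h)%g; first by rewrite !inE eqxx ?orbT.
have [|ix gx] := gX x; first by rewrite !inE eqxx ?orbT.
have [|ixhh gxhh] := gX (x * (h * h))%g; first by rewrite !inE eqxx ?orbT.
have [|ixh gxh] := gX (x * h)%g; first by rewrite !inE eqxx ?orbT.
have [|ihx ghx] := gX (h * x)%g; first by rewrite !inE eqxx ?orbT.
have dK i j k a b : g i = a -> g j = (a * b)%g -> g k = b -> d i j = d i1 k.
  by move=> gi gj gk; apply/dE; rewrite gi gj gk g1 invg1 mul1g mulKg.
have e_l i : (d i1 i1 * d i1 i = d i1 i)%g by [].
have e_r i : (d i1 i * d i1 i1 = d i1 i)%g.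
  by rewrite -(_ : d i i = d i1 i1) //; apply/dE; rewrite !mulVg.
have dh : d ih ihh = d i1 ih := dK _ _ _ _ _ gh ghh gh.
have dh_t : d it ith = d i1 ih := dK _ _ _ _ _ gt gth gh.
have dt : d ihh ith = d i1 it.
  by apply: (dK _ _ _ _ _ ghh _ gt); rewrite gth th.
have dhh : d ix ixhh = d i1 ihh := dK _ _ _ _ _ gx gxhh ghh.
have dx : d ihh ixhh = d i1 ix.
  by apply: (dK _ _ _ _ _ ghh _ gx); rewrite gxhh xhh.
have dh_x : d ix ixh = d i1 ih := dK _ _ _ _ _ gx gxh gh.
have dx_h : d ih ihx = d i1 ix := dK _ _ _ _ _ gh ghx gx.
have hh : (d i1 ih * d i1 ih = d i1 ihh)%g by rewrite -{2}dh.
have comm : (d i1 ix * d i1 ih = d i1 ih * d i1 ix)%g.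
  apply: (@finite_semigroup_commute _ (d i1 i1) _ (d ih i1) (d i1 it) (d it i1)) => //.
  - by rewrite dM; apply/dE; rewrite !mulVg.
  - by rewrite dM; apply/dE; rewrite !mulVg.
  - by rewrite -{1}dh_t dM hh -dt dM.
  - by rewrite hh -{1}dhh dM -dx dM.
move: comm; rewrite -{1}dh_x dM -dx_h dM => /dE.
by rewrite gxh ghx => /mulgI.
Qed.

(** * Permutations of an arbitrary type *)

(** Carrying the inverse makes inversion computable; it is determined by the
    underlying function, see [sym_eqP]. *)
Record sym (X : Type) := Sym {
  sym_fun :> X -> X;
  sym_inv : X -> X;
  sym_funK : cancel sym_fun sym_inv;
  sym_invK : cancel sym_inv sym_fun
}.

Lemma sym_eqP (X : Type) (f g : sym X) : f =1 g -> f = g.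
Proof.
case: f g => [f f' fK f'K] [g g' gK g'K] /= /funext fg; case: _ / fg in gK g'K *.
have f'g' : f' = g' by apply/funext => y; rewrite -[y in LHS]g'K fK.
case: _ / f'g' in gK g'K *.
by congr Sym; exact: Prop_irrelevance.
Qed.

Definition sym_one (X : Type) : sym X :=
  @Sym X id id (fun=> erefl) (fun=> erefl).

Definition sym_mul (X : Type) (f g : sym X) : sym X :=
  Sym (can_comp (sym_funK f) (sym_funK g)) (can_comp (sym_invK g) (sym_invK f)).

Definition sym_opp (X : Type) (f : sym X) : sym X :=
  Sym (sym_invK f) (sym_funK f).

Lemma sym_mulA (X : Type) : associative (@sym_mul X).
Proof. by move=> f g k; exact: sym_eqP. Qed.

Lemma sym_mul1 (X : Type) : left_id (sym_one X) (@sym_mul X).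
Proof. by move=> f; exact: sym_eqP. Qed.

Lemma sym_mulr1 (X : Type) : right_id (sym_one X) (@sym_mul X).
Proof. by move=> f; exact: sym_eqP. Qed.

Lemma sym_mulV (X : Type) : left_inverse (sym_one X) (@sym_opp X) (@sym_mul X).
Proof. by move=> f; apply: sym_eqP => y; exact: sym_funK. Qed.

Lemma sym_mulrV (X : Type) :
  right_inverse (sym_one X) (@sym_opp X) (@sym_mul X).
Proof. by move=> f; apply: sym_eqP => y; exact: sym_invK. Qed.

HB.instance Definition _ (X : Type) := gen_eqMixin (sym X).
HB.instance Definition _ (X : Type) := gen_choiceMixin (sym X).
HB.instance Definition _ (X : Type) := isGroup.Build (sym X)
  (@sym_mulA X) (@sym_mul1 X) (@sym_mulr1 X) (@sym_mulV X) (@sym_mulrV X).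

(** * Three permutations of the rational numbers *)

Definition translation : sym rat := Sym (addrK 1) (subrK 1).

Lemma two_neq0 : 2 != 0 :> rat. Proof. by []. Qed.

Definition doubling : sym rat := Sym (mulfK two_neq0) (divfK two_neq0).

Definition even_rat (y : rat) : bool := y / 2 \is a Num.int.

Lemma even_ratD2 y : even_rat (y + 2) = even_rat y.
Proof. by rewrite /even_rat mulrDl divff ?two_neq0 // rpredDr. Qed.

Lemma even_ratB2 y : even_rat (y - 2) = even_rat y.
Proof. by rewrite -[in RHS](subrK 2 y) even_ratD2. Qed.

Lemma even_shiftK :
  cancel (fun y => if even_rat y then y + 2 else y)
         (fun y => if even_rat y then y - 2 else y).
Proof.
move=> y; case y_even: (even_rat y); last by rewrite y_even.
by rewrite even_ratD2 y_even addrK.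
Qed.

Lemma even_unshiftK :
  cancel (fun y => if even_rat y then y - 2 else y)
         (fun y => if even_rat y then y + 2 else y).
Proof.
move=> y; case y_even: (even_rat y); last by rewrite y_even.
by rewrite even_ratB2 y_even subrK.
Qed.

Definition even_shift : sym rat :=
  Sym even_shiftK even_unshiftK.

Lemma doubling_translation :
  (doubling * translation = translation * translation * doubling)%g.
Proof. by apply: sym_eqP => y /=; ring. Qed.

Lemma even_shift_translation2 :
  (even_shift * (translation * translation)
   = translation * translation * even_shift)%g.
Proof.
apply: sym_eqP => y /=; rewrite -[y + 1 + 1]addrA even_ratD2.
by case: ifP => _; ring.
Qed.

Lemma even_shift_translation_neq :
  (even_shift * translation)%g <> (translation * even_shift)%g.
Proof. by move/(congr1 (fun f : sym rat => f 0)). Qed.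

Theorem corollary5p6 (F : fieldType) (n : nat) (hn : (349 <= n.+1)%N) :
  exists (G : groupType) (V : G -> set 'M[F]_n.+1),
    [/\ ~ finite_set [set: G],
        is_grading V
      & forall (T : semigroupType) (B : algType F) (W : T -> set B),
          finite_set [set: T] -> is_grading W -> ~ weakly_equivalent V W].
Proof.
pose X := obstruction translation doubling even_shift.
pose g (i : 'I_n.+1) := nth 1%g X i.
have gX a : a \in X -> exists i, g i = a.
  move=> /(nthP 1%g)[k kX <-].
  have kn : (k < n.+1)%N by apply: leq_trans hn; apply: leq_trans kX _.
  by exists (Ordinal kn).
have noT (T : semigroupType) (B : algType F) (W : T -> set B) :
    finite_set [set: T] -> is_grading W ->
    ~ weakly_equivalent (elementary_grading (F := F) g) W.
  move=> finT gradW /(weak_equivalence_degrees gradW)[d [dM dE]].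
  apply: even_shift_translation_neq.
  exact: (difference_table_commute doubling_translation
            even_shift_translation2 gX finT dM dE).
have gradV := elementary_grading_is_grading F g.
exists (sym rat), (elementary_grading (F := F) g); split=> // finG.
apply: (noT _ _ _ finG gradV); exists idfun; split; first by exists id.
by move=> s _; exists s; rewrite image_id.
Qed.
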